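(* Let $\sigma>1$. For a family of smooth closed strictly convex surfaces $M_t\subset\mathbb{R}^3$ flowing according to $\frac{d}{dt}X=-K^{\sigma}\nu$, where $K$ is the Gauss curvature and $\nu$ the outer unit normal, there exist no maximum-principle functions; that is, there is no maximum-principle function (in the sense defined in the context) for the normal velocity $F=K^\sigma=(\lambda_1\lambda_2)^\sigma$.
   Context: $X$ is the embedding vector of $M_t$. Principal curvatures of a strictly convex surface are denoted $\lambda_1,\lambda_2>0$; $H=\lambda_1+\lambda_2$ is the mean curvature and $K=\lambda_1\lambda_2$ the Gauss curvature. For a flow $\frac{d}{dt}X=-F\nu$ with $F$ a homogeneous symmetric function of $(\lambda_1,\lambda_2)$, put $L(w):=\frac{d}{dt}w-F^{ij}w_{;ij}$, where $F^{ij}=\partial F/\partial h_{ij}$, $(h_{ij})$ is the second fundamental form, $(g_{ij})$ is the induced metric and semicolons denote covariant derivatives. A symmetric function $w$ of $(\lambda_1,\lambda_2)$ is also regarded as a function $w(H,K)$; subscripts $w_H,w_K,w_{HH},w_{HK},w_{KK}$ are partial derivatives with respect to $H,K$, evaluated at $H=\lambda_1+\lambda_2$, $K=\lambda_1\lambda_2$. At a critical point of $w$ (that is, $w_{;i}=0$ for $i=1,2$), in coordinates with $g_{ij}=\delta_{ij}$ and $(h_{ij})=\mathrm{diag}(\lambda_1,\lambda_2)$ at the point, $L(w)$ fulfills an identity $$L(w)=C_w(\lambda_1,\lambda_2)+G_w(\lambda_1,\lambda_2)\,h_{11;1}^2+G_w(\lambda_2,\lambda_1)\,h_{22;2}^2,$$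 where, writing $F_i=\partial F/\partial\lambda_i$, $F_{ij}=\partial^2F/\partial\lambda_i\partial\lambda_j$ and $a_1=-\frac{w_H+\lambda_2w_K}{w_H+\lambda_1w_K}$, $$C_w(\lambda_1,\lambda_2)=\big(F(\lambda_1^2+\lambda_2^2)+(F_1-F_2)(\lambda_1-\lambda_2)\lambda_1\lambda_2\big)w_H+\big(F(\lambda_1+\lambda_2)+(F_1\lambda_1-F_2\lambda_2)(\lambda_1-\lambda_2)\big)\lambda_1\lambda_2\,w_K,$$ $$\begin{aligned}G_w(\lambda_1,\lambda_2)={}&\Big(F_{11}+2F_{12}a_1+F_{22}a_1^2+2\tfrac{F_1-F_2}{\lambda_1-\lambda_2}a_1^2\Big)w_H\\&+\Big(2(-F_1a_1+F_2a_1^2)+(F_{11}+2F_{12}a_1+F_{22}a_1^2)\lambda_2+2\tfrac{F_1-F_2}{\lambda_1-\lambda_2}a_1^2\lambda_1\Big)w_K\\&-F_1\Big((1+a_1)^2w_{HH}+2(1+a_1)(\lambda_2+\lambda_1a_1)w_{HK}+(\lambda_2+\lambda_1a_1)^2w_{KK}\Big).\end{aligned}$$ For $\lambda_1=\lambda_2$ the quotient $\frac{F_1-F_2}{\lambda_1-\lambda_2}$ is interpreted as a limit. The rational function $C_w$ is called the constant terms and the rational function $G_w$ the gradient terms of the evolution equation. Definition (maximum-principle function). Let $w=p(\lambda_1,\lambda_2)/q(\lambda_1,\lambda_2)$ be a symmetric rational function of the principal curvatures, where $p\not\equiv0$ and $q\not\equiv0$ are homogeneous polynomials. $w$ is called a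 maximum-principle function for the normal velocity $F$ if: (1) (a) $p(\lambda_1,\lambda_2)\ge0$ and $q(\lambda_1,\lambda_2)>0$ for all $\lambda_1,\lambda_2>0$; (b) $p(\lambda_1,\lambda_2)=0$ for $\lambda_1=\lambda_2>0$. (2) $\deg p>\deg q$. (3) $\frac{\partial w(\rho,1)}{\partial\rho}<0$ for all $0<\rho<1$ and $\frac{\partial w(\rho,1)}{\partial\rho}>0$ for all $\rho>1$. (4) $L(w)\le0$ for all $\lambda_1,\lambda_2>0$, which is achieved by assuming: (a) the terms without derivatives of $(h_{ij})$ are nonpositive; and (b) the terms involving derivatives of $(h_{ij})$ at a critical point of $w$, i.e. where $w_{;i}=0$ for $i=1,2$, are nonpositive. That is, the constant terms $C_w(\lambda_1,\lambda_2)$ and the gradient terms $G_w(\lambda_1,\lambda_2)$ are simultaneously nonpositive for all $\lambda_1,\lambda_2>0$. *)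

(* Defs.v *)
From mathcomp Require Import all_boot all_order all_fingroup all_algebra.
From mathcomp Require Import all_classical all_reals all_analysis.
From mathcomp Require Import ring.
(* Its notations clash with those of mathcomp-analysis. *)
From mathcomp Require Import -(notations) mpoly.

Set Implicit Arguments.
Unset Strict Implicit.
Unset Printing Implicit Defensive.

Import Order.TTheory GRing.Theory Num.Theory.
Import numFieldNormedType.Exports.

Local Open Scope classical_set_scope.
Local Open Scope ring_scope.

Section TwoVariables.
Variable R : realType.
Implicit Types (f F w W : R -> R -> R) (x y H K : R).

Definition pd1 f x y : R := derive1 (fun t => f t y) x.
Definition pd2 f x y : R := derive1 (fun t => f x t) y.

Definition eval2 (p : mpoly 2 R) x y : R :=
  meval (fun i : 'I_2 => if i == ord0 then x else y) p.

Definition ratfun (p q : mpoly 2 R) x y : R := eval2 p x y / eval2 q x y.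

(* On the diagonal, division by zero returns a junk value (zero); the quotients
   that are singular there are read as their limits. *)
Definition ext_diag f x y : R := if x == y then lim (f t y @[t --> x^']) else f x y.

(* W is the rational function w regarded as a function of
   H = l1 + l2 and K = l1 * l2. The nonvanishing of the denominator at all
   relevant points determines the partial derivatives of W there, also for
   l1 = l2, i.e. on the boundary H^2 = 4K of the set of attained (H, K). *)
Definition as_function_of_HK w W : Prop :=
  exists P Q : mpoly 2 R,
    W = ratfun P Q /\
    forall l1 l2, 0 < l1 -> 0 < l2 ->
      eval2 Q (l1 + l2) (l1 * l2) != 0 /\ W (l1 + l2) (l1 * l2) = w l1 l2.

Section EvolutionTerms.
Variables F W : R -> R -> R.

Let F1 := pd1 F.
Let F2 := pd2 F.
Let F11 := pd1 (pd1 F).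
Let F12 := pd2 (pd1 F).
Let F22 := pd2 (pd2 F).
Let wH l1 l2 := pd1 W (l1 + l2) (l1 * l2).
Let wK l1 l2 := pd2 W (l1 + l2) (l1 * l2).
Let wHH l1 l2 := pd1 (pd1 W) (l1 + l2) (l1 * l2).
Let wHK l1 l2 := pd2 (pd1 W) (l1 + l2) (l1 * l2).
Let wKK l1 l2 := pd2 (pd2 W) (l1 + l2) (l1 * l2).

Definition constant_terms l1 l2 : R :=
  (F l1 l2 * (l1 ^+ 2 + l2 ^+ 2)
     + (F1 l1 l2 - F2 l1 l2) * (l1 - l2) * l1 * l2) * wH l1 l2
  + (F l1 l2 * (l1 + l2)
     + (F1 l1 l2 * l1 - F2 l1 l2 * l2) * (l1 - l2)) * l1 * l2 * wK l1 l2.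

Definition F_quotient : R -> R -> R :=
  ext_diag (fun l1 l2 => (F1 l1 l2 - F2 l1 l2) / (l1 - l2)).

(* At a critical point of w, h_{22;1} = a1 * h_{11;1}. Since both numerator and
   denominator vanish for l1 = l2, this is extended by its limit as well. *)
Definition a1 : R -> R -> R :=
  ext_diag (fun l1 l2 =>
    - ((wH l1 l2 + l2 * wK l1 l2) / (wH l1 l2 + l1 * wK l1 l2))).

Definition gradient_terms l1 l2 : R :=
  let a := a1 l1 l2 in
  let D := F_quotient l1 l2 in
  let F_aa := F11 l1 l2 + 2 * F12 l1 l2 * a + F22 l1 l2 * a ^+ 2 in
  (F_aa + 2 * D * a ^+ 2) * wH l1 l2
  + (2 * (- (F1 l1 l2 * a) + F2 l1 l2 * a ^+ 2) + F_aa * l2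
     + 2 * D * a ^+ 2 * l1) * wK l1 l2
  - F1 l1 l2 * ((1 + a) ^+ 2 * wHH l1 l2
                + 2 * (1 + a) * (l2 + l1 * a) * wHK l1 l2
                + (l2 + l1 * a) ^+ 2 * wKK l1 l2).

End EvolutionTerms.

Record maximum_principle_function F (p q : mpoly 2 R) : Prop := {
  mpf_p_neq0 : p != 0;
  mpf_q_neq0 : q != 0;
  mpf_p_homog : p \is ishomog mdeg;
  mpf_q_homog : q \is ishomog mdeg;
  mpf_sym : forall l1 l2, 0 < l1 -> 0 < l2 -> ratfun p q l1 l2 = ratfun p q l2 l1;
  mpf_p_ge0 : forall l1 l2, 0 < l1 -> 0 < l2 -> 0 <= eval2 p l1 l2;
  mpf_q_gt0 : forall l1 l2, 0 < l1 -> 0 < l2 -> 0 < eval2 q l1 l2;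
  mpf_p_diag : forall l, 0 < l -> eval2 p l l = 0;
  (* msize is the degree plus one *)
  mpf_deg : (mpoly.msize q < mpoly.msize p)%N;
  mpf_decr : forall rho, 0 < rho -> rho < 1 -> pd1 (ratfun p q) rho 1 < 0;
  mpf_incr : forall rho, 1 < rho -> 0 < pd1 (ratfun p q) rho 1;
  mpf_evolution : exists2 W, as_function_of_HK (ratfun p q) W &
    forall l1 l2, 0 < l1 -> 0 < l2 ->
      constant_terms F W l1 l2 <= 0 /\ gradient_terms F W l1 l2 <= 0
}.

Definition gauss_power (sigma : R) l1 l2 : R := (l1 * l2) `^ sigma.

Lemma eval2_msym (s : 'S_2) (p : mpoly 2 R) x y :
  eval2 (msym s p) x y = meval (fun i => if s i == ord0 then x else y) p.
Proof.
rewrite /eval2 [in LHS](mpolyE p) [in RHS](mpolyE p).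
rewrite (raddf_sum (msym s)) !(raddf_sum (meval _)); apply: eq_bigr => m _ /=.
rewrite msymZ msymX !mevalZ !mevalX; congr (_ * _).
rewrite (reindex_inj (@perm_inj _ s)); apply: eq_bigr => i _.
by rewrite mnmE permK.
Qed.

Lemma eval2_sym (p : mpoly 2 R) : p \is symmetric ->
  exists t : mpoly 2 R, forall x y, eval2 p x y = eval2 t (x + y) (x * y).
Proof.
move=> /sym_fundamental[t [<- _]]; exists t => x y.
rewrite /eval2 comp_mpoly_meval; apply: meval_eq => i.
rewrite tnth_mktuple; case: i => -[|[|//]] /= lti.
  by rewrite mesym1E linear_sum /= !big_ord_recl big_ord0 /= !mevalXU addr0.
rewrite (mesymnnE 2) rmorph_prod /= !big_ord_recl big_ord0 /=.
by rewrite !mevalXU mulr1.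
Qed.

Lemma S2P (s : 'S_2) : s = 1%g \/ s = tperm ord0 ord_max.
Proof.
have H (i : 'I_2) : i = ord0 \/ i = ord_max.
  by case: i => -[|[|//]] lti; [left|right]; apply: val_inj.
have ne : s ord0 != s ord_max by rewrite (inj_eq perm_inj).
case: (H (s ord0)) (H (s ord_max)) ne => [] s0 [] s1; rewrite s0 s1 ?eqxx // => _.
  by left; apply/permP => i; rewrite perm1; case: (H i) => ->.
by right; apply/permP => i; case: (H i) => ->; rewrite ?tpermL ?tpermR.
Qed.

(* A symmetric p / q always is a rational function of H and K, so that the
   existential quantifier in mpf_evolution does not restrict the definition. *)
Lemma as_function_of_HK_ex (p q : mpoly 2 R) :
  (forall l1 l2, 0 < l1 -> 0 < l2 -> ratfun p q l1 l2 = ratfun p q l2 l1) ->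
  (forall l1 l2, 0 < l1 -> 0 < l2 -> 0 < eval2 q l1 l2) ->
  exists W, as_function_of_HK (ratfun p q) W.
Proof.
move=> wC q_gt0; pose s : 'S_2 := tperm ord0 ord_max.
have ss : (s * s = 1)%g by apply/permP => i; rewrite permM tpermK perm1.
have sE r x y : eval2 (msym s r) x y = eval2 r y x.
  rewrite eval2_msym; apply: meval_eq => -[[|[|//]]] lti.
    by rewrite (_ : Ordinal _ = ord0) ?tpermL //; apply: val_inj.
  by rewrite (_ : Ordinal _ = ord_max) ?tpermR //; apply: val_inj.
have [P PE] : exists t : mpoly 2 R, forall x y,
    eval2 (p * msym s q + msym s p * q) x y = eval2 t (x + y) (x * y).
  apply: eval2_sym; apply/issymP => u; case: (S2P u) => ->; first exact: msym1m.
  by rewrite -/s msymD !msymM -!msymMm ss !msym1m addrC.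
have [Q QE] : exists t : mpoly 2 R, forall x y,
    eval2 (q * msym s q *+ 2) x y = eval2 t (x + y) (x * y).
  apply: eval2_sym; apply/issymP => u; case: (S2P u) => ->; first exact: msym1m.
  by rewrite -/s msymMn msymM -msymMm ss msym1m mulrC.
exists (ratfun P Q), P, Q; split=> // l1 l2 l1_gt0 l2_gt0.
have q12 := lt0r_neq0 (q_gt0 _ _ l1_gt0 l2_gt0).
have q21 := lt0r_neq0 (q_gt0 _ _ l2_gt0 l1_gt0).
have Q12 : eval2 Q (l1 + l2) (l1 * l2) = eval2 q l1 l2 * eval2 q l2 l1 *+ 2.
  by rewrite -QE {1}/eval2 mevalMn mevalM -/(eval2 _ _ _) -/(eval2 _ _ _) sE.
have P12 : eval2 P (l1 + l2) (l1 * l2) =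
    eval2 p l1 l2 * eval2 q l2 l1 + eval2 p l2 l1 * eval2 q l1 l2.
  by rewrite -PE {1}/eval2 mevalD !mevalM -!/(eval2 _ _ _) !sE.
split; first by rewrite Q12 mulrn_eq0 /= mulf_neq0.
have := wC _ _ l1_gt0 l2_gt0; rewrite /ratfun Q12 P12 => e.
have -> : eval2 p l2 l1 = eval2 p l1 l2 / eval2 q l1 l2 * eval2 q l2 l1.
  by rewrite e divfK.
by field; rewrite q12 q21.
Qed.

End TwoVariables.

(* Main.v *)
Require Import Defs.
From mathcomp Require Import all_boot all_order all_algebra.
From mathcomp Require Import all_classical all_reals all_analysis.
From mathcomp Require Import ring lra.
From mathcomp Require Import -(notations) mpoly.

Set Implicit Arguments.
Unset Strict Implicit.
Unset Printing Implicit Defensive.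

Import Order.TTheory GRing.Theory Num.Theory.
Import numFieldNormedType.Exports.
Local Open Scope classical_set_scope.
Local Open Scope ring_scope.

(** Write u(s) = w(s, 1) and let d > 0 be the degree of homogeneity of w.  The
contradiction comes from the gradient terms at (s, 1) as s tends to infinity.

On a level curve of w, parametrized by (log l1, log l2), the gradient terms
take a simple form: if q(s) = s u'(s) / u(s) denotes the logarithmic
derivative of the profile u, then, for F = K^sigma and s > 1, the inequality
G_w(s, 1) <= 0 says exactly that
  d^2 s q' >= q (2 q - d) (sigma (2 q - d) - q (s + 1) / (s - 1)).
This is [gradient_form_gauss]; its ingredients are the partial derivatives of
w as a function of H and K at (s + 1, s).  As w is homogeneous, Euler's relation
and its derivatives express the two first order derivatives, and the second
order derivatives as far as they occur, in terms of u, u', u'' (lemmas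
[euler_profile], [euler_profile_deriv], [euler_second]).

The monotonicity condition enters through symmetry: w(s, 1) = s^d w(1/s, 1), so
that the decrease of w(rho, 1) for rho < 1 becomes q(s) > d for s > 1
([ratfun_steep]).  Hence 2 q - d >= q, and since sigma > 1 while
(s + 1) / (s - 1) tends to 1, the inequality yields s q' >= e q^3 for large s,
with some e > 0.  This Riccati type inequality has no solution up to infinity:
(1 / q)^2 would decrease at least like a multiple of - ln s, although it is
nonnegative ([no_steep_profile]). *)

(** * Derivatives of functions of one variable *)

Section OneVariable.
Variable R : realType.
Implicit Types (f g : R -> R) (t : R).

Lemma is_derive_add f g t df dg : is_derive t 1 f df -> is_derive t 1 g dg ->
  is_derive t 1 (fun x => f x + g x) (df + dg).
Proof. by move=> hf hg; exact: is_deriveD. Qed.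

Lemma is_derive_mul f g t df dg : is_derive t 1 f df -> is_derive t 1 g dg ->
  is_derive t 1 (fun x => f x * g x) (df * g t + f t * dg).
Proof.
move=> hf hg; apply: (is_derive_eq (is_deriveM hf hg)).
by rewrite addrC [g t *: _]mulrC.
Qed.

Lemma is_derive_exp f t df n : is_derive t 1 f df ->
  is_derive t 1 (fun x => f x ^+ n) (f t ^+ n.-1 *+ n * df).
Proof.
move=> hf; have h := is_deriveX n hf.
rewrite [X in is_derive _ _ X _](_ : _ = f ^+ n); last first.
  by apply/funext => x; rewrite exprfctE.
by apply: (is_derive_eq h); rewrite mulr_natl.
Qed.

Lemma is_derive_div f g t df dg : g t != 0 ->
  is_derive t 1 f df -> is_derive t 1 g dg ->
  is_derive t 1 (fun x => f x / g x) ((df * g t - f t * dg) / g t ^+ 2).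
Proof.
move=> g0 hf hg; have hV := is_deriveV g0 hg.
apply: (is_derive_eq (is_derive_mul hf hV)).
by rewrite /GRing.scale /=; field.
Qed.

Lemma is_derive_continuous f t df :
  is_derive t 1 f df -> f x @[x --> t] --> f t.
Proof.
by move=> [hf _]; apply/differentiable_continuous/derivable1_diffP.
Qed.

Lemma is_derive_derive1 f t df : is_derive t 1 f df -> derive1 f t = df.
Proof. by move=> [_ <-]; rewrite derive1E. Qed.

Lemma near_is_derive_uniq f g t df dg : (\forall x \near t, f x = g x) ->
  is_derive t 1 f df -> is_derive t 1 g dg -> df = dg.
Proof. by move=> fg /(near_eq_is_derive fg)[_ <-] [_ <-]. Qed.

End OneVariable.

(** * Derivatives of rational functions of two variables along curves *)

Section Rational.
Variable R : realType.
Implicit Types (P Q : mpoly 2 R) (f : R -> R -> R).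

Lemma eval2D P Q x y : eval2 (P + Q) x y = eval2 P x y + eval2 Q x y.
Proof. exact: mevalD. Qed.
Lemma eval2B P Q x y : eval2 (P - Q) x y = eval2 P x y - eval2 Q x y.
Proof. exact: mevalB. Qed.
Lemma eval2M P Q x y : eval2 (P * Q) x y = eval2 P x y * eval2 Q x y.
Proof. exact: mevalM. Qed.
Lemma eval2Mn P k x y : eval2 (P *+ k) x y = eval2 P x y *+ k.
Proof. exact: mevalMn. Qed.
Lemma eval2Z c P x y : eval2 (c *: P) x y = c * eval2 P x y.
Proof. exact: mevalZ. Qed.
Lemma eval2Xm m x y : eval2 (mpolyX R m) x y = x ^+ m ord0 * y ^+ m ord_max.
Proof.
rewrite /eval2 mevalX !big_ord_recl big_ord0 mulr1 /=; congr (_ * _ ^+ m _).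
exact: val_inj.
Qed.

Lemma eval2_mderiv_monomial m x y :
  eval2 (mderiv ord0 (mpolyX R m)) x y
    = x ^+ (m ord0).-1 *+ m ord0 * y ^+ m ord_max /\
  eval2 (mderiv ord_max (mpolyX R m)) x y
    = x ^+ m ord0 * (y ^+ (m ord_max).-1 *+ m ord_max).
Proof.
by split; rewrite mderivX eval2Z eval2Xm !mnmBE !mnm1E /= subn0 subn1; ring.
Qed.

Lemma is_derive_eval2 P (a b : R -> R) (t da db : R) :
  is_derive t 1 a da -> is_derive t 1 b db ->
  is_derive t 1 (fun t => eval2 P (a t) (b t))
    (eval2 (mderiv ord0 P) (a t) (b t) * da
     + eval2 (mderiv ord_max P) (a t) (b t) * db).
Proof.
move=> ha hb; elim/mpolyind: P => [|c m P _ _ IH].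
  under eq_fun do rewrite /eval2 meval0.
  by rewrite !mderiv0 /eval2 meval0 !mul0r addr0; exact: is_derive_cst.
rewrite !mderivD !mderivZ !eval2D !eval2Z.
under eq_fun do rewrite eval2D eval2Z eval2Xm.
have [-> ->] := eval2_mderiv_monomial m (a t) (b t).
have hc : is_derive t 1 (cst c : R -> R) 0 by exact: is_derive_cst.
have hm := is_derive_mul (is_derive_exp (m ord0) ha)
  (is_derive_exp (m ord_max) hb).
apply: (is_derive_eq (is_derive_add
  (is_derive_mul hc hm) IH)).
by rewrite /=; ring.
Qed.

(** The exponent is kept apart from the denominator because this class, for a
fixed Q, is closed under partial derivatives: only P and k change, and all
derivatives exist wherever Q does not vanish. *)
Definition quotient_off Q P k f :=
  forall x y, eval2 Q x y != 0 -> f x y = eval2 P x y / eval2 Q x y ^+ k.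

(** The numerator of the derivative of P / Q ^ k over the denominator
Q ^ k.+1, with one factor Q ^ k.-1 cancelled. *)
Definition quotient_deriv (i : 'I_2) Q P k : mpoly 2 R :=
  mderiv i P * Q - P * mderiv i Q *+ k.

Lemma is_derive_quotient Q P k f (a b : R -> R) (t da db : R) :
  quotient_off Q P k f -> eval2 Q (a t) (b t) != 0 ->
  is_derive t 1 a da -> is_derive t 1 b db ->
  is_derive t 1 (fun t => f (a t) (b t))
    ((eval2 (quotient_deriv ord0 Q P k) (a t) (b t) * da
      + eval2 (quotient_deriv ord_max Q P k) (a t) (b t) * db)
     / eval2 Q (a t) (b t) ^+ k.+1).
Proof.
move=> fE Q0 ha hb.
have hP := is_derive_eval2 P ha hb.
have hQ := is_derive_eval2 Q ha hb.
have hQk := is_derive_exp k hQ.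
have Qk0 : eval2 Q (a t) (b t) ^+ k != 0 by rewrite expf_neq0.
(* Q does not vanish near the point, so that f is the quotient there. *)
apply: (near_eq_is_derive
  (f := fun t => eval2 P (a t) (b t) / eval2 Q (a t) (b t) ^+ k)).
  have := cvgr_neq0 _ (is_derive_continuous hQ) Q0.
  by move=> h; near=> x; rewrite fE //; near: x; exact: h.
apply: (is_derive_eq
  (is_derive_div (t := t) (g := fun t => _ ^+ k) Qk0 hP hQk)).
rewrite /quotient_deriv !(eval2B, eval2M, eval2Mn).
case: k {fE hQk} Qk0 => [|k] _ /=; first by field.
rewrite !exprS; field.
by rewrite Q0 expf_neq0.
Unshelve. all: by end_near.
Qed.

(** Differentiability at (x, y) expressed by the chain rule, since w as a
function of H and K gets differentiated along two kinds of curves: those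
belonging to the points (s, 1) and those belonging to the rays t (s, 1). *)
Definition has_gradient f (x y d1 d2 : R) :=
  forall (a b : R -> R) (t da db : R), a t = x -> b t = y ->
    is_derive t 1 a da -> is_derive t 1 b db ->
    is_derive t 1 (fun t => f (a t) (b t)) (d1 * da + d2 * db).

Lemma pd1_quotient Q P k f : quotient_off Q P k f ->
  quotient_off Q (quotient_deriv ord0 Q P k) k.+1 (pd1 f).
Proof.
move=> fE x y Q0.
have := is_derive_quotient (a := id) (b := fun=> y) (t := x) fE Q0
  (is_derive_id _ _) (is_derive_cst _ _ _).
move/is_derive_derive1; rewrite /pd1 => ->.
by rewrite mulr1 mulr0 addr0.
Qed.

Lemma pd2_quotient Q P k f : quotient_off Q P k f ->
  quotient_off Q (quotient_deriv ord_max Q P k) k.+1 (pd2 f).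
Proof.
move=> fE x y Q0.
have := is_derive_quotient (a := fun=> x) (b := id) (t := y) fE Q0
  (is_derive_cst _ _ _) (is_derive_id _ _).
move/is_derive_derive1; rewrite /pd2 => ->.
by rewrite mulr1 mulr0 add0r.
Qed.

Lemma quotient_has_gradient Q P k f x y :
  quotient_off Q P k f -> eval2 Q x y != 0 ->
  has_gradient f x y (pd1 f x y) (pd2 f x y).
Proof.
move=> fE Q0 a b t da db ax ay ha hb.
move: Q0; rewrite -ax -ay => Q0.
apply: (is_derive_eq (is_derive_quotient fE Q0 ha hb)).
by rewrite (pd1_quotient fE) // (pd2_quotient fE) //; ring.
Qed.

Lemma quotient_pd_comm Q P k f x y : quotient_off Q P k f -> eval2 Q x y != 0 ->
  pd1 (pd2 f) x y = pd2 (pd1 f) x y.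
Proof.
move=> fE Q0.
have num :
  eval2 (quotient_deriv ord0 Q (quotient_deriv ord_max Q P k) k.+1) x y =
  eval2 (quotient_deriv ord_max Q (quotient_deriv ord0 Q P k) k.+1) x y.
  rewrite /quotient_deriv !(mderivB, mderivMn, mderivM).
  rewrite !(eval2B, eval2M, eval2Mn, eval2D).
  by rewrite (mderiv_comm ord0 ord_max P) (mderiv_comm ord0 ord_max Q); ring.
have e1 := pd1_quotient (pd2_quotient fE) Q0.
rewrite num in e1.
have e2 := pd2_quotient (pd1_quotient fE) Q0.
exact (etrans e1 (esym e2)).
Qed.

Lemma quotient_off_ratfun P Q : quotient_off Q P 1 (ratfun P Q).
Proof. by move=> x y _; rewrite expr1. Qed.

Lemma eval2_homog P t x y : P \is ishomog mdeg ->
  eval2 P (t * x) (t * y) = t ^+ (mpoly.msize P).-1 * eval2 P x y.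
Proof.
move=> /dhomogP hP; rewrite /eval2 !mevalE big_distrr /=.
apply: eq_big_seq => m /hP /= <-.
rewrite !big_ord_recl !big_ord0 !mulr1 /= mdegE !big_ord_recl big_ord0 addn0.
by rewrite exprD !exprMn; ring.
Qed.

End Rational.

(** * Derivatives of powers of the Gauss curvature *)

Section GaussPower.
Variable R : realType.
Implicit Types (x y s sigma : R).

Lemma is_derive_affine (c s : R) : is_derive s 1 (fun x => x * c) c.
Proof.
have h := is_derive_mul (is_derive_id s 1) (is_derive_cst c s 1).
by apply: (is_derive_eq h); rewrite mul1r mulr0 addr0.
Qed.

Lemma gauss_powerC sigma x y : gauss_power sigma x y = gauss_power sigma y x.
Proof. by rewrite /gauss_power mulrC. Qed.

Lemma gauss_powerS sigma x y : 0 < x -> 0 < y ->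
  gauss_power sigma x y = x * y * gauss_power (sigma - 1) x y.
Proof.
move=> x0 y0; have xy0 : 0 < x * y by rewrite mulr_gt0.
rewrite /gauss_power -{2}(powRr1 (ltW xy0)) -powRD; last first.
  by rewrite (gt_eqF xy0) implybT.
by rewrite [1 + _]addrC subrK.
Qed.

Lemma is_derive_gauss_power sigma x y : 0 < x -> 0 < y ->
  is_derive x 1 (fun t => gauss_power sigma t y)
    (sigma * y * gauss_power (sigma - 1) x y).
Proof.
move=> x0 y0; have xy0 : 0 < x * y by rewrite mulr_gt0.
have h := is_derive1_comp (g := fun t => t * y) (is_derive1_powR sigma xy0)
  (is_derive_affine y x).
by apply: (is_derive_eq h); rewrite /gauss_power mulrAC.
Qed.

Lemma pd1_gauss sigma x y : 0 < x -> 0 < y ->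
  pd1 (gauss_power sigma) x y = sigma * y * gauss_power (sigma - 1) x y.
Proof. by move=> x0 y0; apply/is_derive_derive1/is_derive_gauss_power. Qed.

Lemma pd2_gauss sigma x y : 0 < x -> 0 < y ->
  pd2 (gauss_power sigma) x y = sigma * x * gauss_power (sigma - 1) x y.
Proof.
move=> x0 y0; rewrite /pd2; under eq_fun do rewrite gauss_powerC.
by rewrite gauss_powerC; apply/is_derive_derive1/is_derive_gauss_power.
Qed.

Lemma pd11_gauss sigma x y : 0 < x -> 0 < y ->
  pd1 (pd1 (gauss_power sigma)) x y
    = sigma * (sigma - 1) * y ^+ 2 * gauss_power (sigma - 1 - 1) x y.
Proof.
move=> x0 y0; apply: is_derive_derive1.
apply: (near_eq_is_derive
  (f := fun t : R => sigma * y * gauss_power (sigma - 1) t y)).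
  by near=> t; rewrite pd1_gauss //; near: t; exact: lt_nbhsr.
have h := is_derive_mul (is_derive_cst (sigma * y) x 1)
  (is_derive_gauss_power (sigma - 1) x0 y0).
by apply: (is_derive_eq h); rewrite /=; ring.
Unshelve. all: by end_near. Qed.

Lemma pd22_gauss sigma x y : 0 < x -> 0 < y ->
  pd2 (pd2 (gauss_power sigma)) x y
    = sigma * (sigma - 1) * x ^+ 2 * gauss_power (sigma - 1 - 1) x y.
Proof.
move=> x0 y0; apply: is_derive_derive1.
apply: (near_eq_is_derive
  (f := fun t : R => sigma * x * gauss_power (sigma - 1) t x)).
  near=> t; rewrite pd2_gauss // 1?gauss_powerC //.
  by near: t; exact: lt_nbhsr.
have h := is_derive_mul (is_derive_cst (sigma * x) y 1)
  (is_derive_gauss_power (sigma - 1) y0 x0).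
by apply: (is_derive_eq h); rewrite /= !(gauss_powerC _ y x); ring.
Unshelve. all: by end_near. Qed.

Lemma pd12_gauss sigma x y : 0 < x -> 0 < y ->
  pd2 (pd1 (gauss_power sigma)) x y
    = sigma ^+ 2 * (x * y) * gauss_power (sigma - 1 - 1) x y.
Proof.
move=> x0 y0; apply: is_derive_derive1.
apply: (near_eq_is_derive
  (f := fun t : R => t * sigma * gauss_power (sigma - 1) t x)).
  near=> t; rewrite pd1_gauss // 1?gauss_powerC 1?[t * _]mulrC //.
  by near: t; exact: lt_nbhsr.
have h := is_derive_mul (is_derive_affine sigma y)
  (is_derive_gauss_power (sigma - 1) y0 x0).
apply: (is_derive_eq h).
by rewrite /= !(gauss_powerC _ y x) (gauss_powerS _ x0 y0); ring.
Unshelve. all: by end_near. Qed.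

End GaussPower.

(** * The gradient terms at (s, 1) in terms of the profile *)

Section Algebra.
Variable R : realType.

(** The gradient terms at (s, 1) for s <> 1, with the values of the derivatives
of F and of w as independent numbers: this separates the field identities from
all differentiation. *)
Definition gradient_form (s F1 F2 F11 F12 F22 wH wK wHH wHK wKK : R) : R :=
  let D := (F1 - F2) / (s - 1) in
  let a := - ((wH + wK) / (wH + s * wK)) in
  let F_aa := F11 + 2 * F12 * a + F22 * a ^+ 2 in
  (F_aa + 2 * D * a ^+ 2) * wH
  + (2 * (- (F1 * a) + F2 * a ^+ 2) + F_aa + 2 * D * a ^+ 2 * s) * wK
  - F1 * ((1 + a) ^+ 2 * wHH + 2 * (1 + a) * (1 + s * a) * wHK
          + (1 + s * a) ^+ 2 * wKK).

(** The second derivatives of w enter the gradient terms only through the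
Hessian applied twice to (1 + a, 1 + s a), the tangent of the level curve.  This
vector equals (1 - s a) (1, 1) + a (s + 1, 2 s), a combination of the tangent of
the profile curve and of the radial direction; on these two the Hessian is
known from the profile and from homogeneity, by the last three hypotheses.
Divided by u^3, the statement that the last factor on the right is nonpositive
is the differential inequality for q = s u' / u. *)
Lemma gradient_form_gauss (sigma d s k u u1 u2 wH wK wHH wHK wKK : R) :
  0 < s -> s != 1 -> s * u1 - d * u != 0 ->
  wH + wK = u1 ->
  (s + 1) * wH + 2 * s * wK = d * u ->
  wHH + 2 * wHK + wKK = u2 ->
  wH + 2 * wK + (s + 1) * (wHH + wHK) + 2 * s * (wHK + wKK) = d * u1 ->
  2 * s * wK + (s + 1) ^+ 2 * wHH + 4 * s * (s + 1) * wHK + 4 * s ^+ 2 * wKK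
    = d * (d - 1) * u ->
  let A := s * u1 in
  gradient_form s (sigma * s * k) (sigma * s ^+ 2 * k)
    (sigma * (sigma - 1) * k) (sigma ^+ 2 * s * k)
    (sigma * (sigma - 1) * s ^+ 2 * k) wH wK wHH wHK wKK =
  sigma * k / s / (A - d * u) ^+ 2 *
  (A * (2 * A - d * u) * (sigma * (2 * A - d * u) - (s + 1) / (s - 1) * A)
   - d ^+ 2 * s * u * ((u1 + s * u2) * u - A * u1)).
Proof.
move=> s_gt0 s1 nz e1 e2 e3 e4 e5 A.
rewrite /gradient_form; set F1 := sigma * s * k; set F2 := sigma * s ^+ 2 * k.
set F11 := sigma * (sigma - 1) * k; set F12 := sigma ^+ 2 * s * k.
set F22 := sigma * (sigma - 1) * s ^+ 2 * k; set D := (F1 - F2) / _.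
set a := - _; set F_aa := F11 + _ + _.
have s0 : s != 0 by rewrite gt_eqF.
have s10 : s - 1 != 0 by rewrite subr_eq0.
have aE : a = u1 / (A - d * u).
  rewrite /a e1; have -> : wH + s * wK = - (A - d * u).
    by rewrite /A -e1 -e2; ring.
  by rewrite invrN mulrN opprK.
(* The decomposition of the tangent vector, applied to the quadratic form. *)
have hess : (1 + a) ^+ 2 * wHH + 2 * (1 + a) * (1 + s * a) * wHK
            + (1 + s * a) ^+ 2 * wKK =
    (1 - s * a) ^+ 2 * u2 + 2 * a * (1 - s * a) * (d * u1 - wH - 2 * wK)
    + a ^+ 2 * (d * (d - 1) * u - 2 * s * wK).
  by rewrite -e3 -e4 -e5; ring.
rewrite hess.
(* The two first order relations determine the gradient of w. *)
have wKE : wK = (d * u - (s + 1) * u1) / (s - 1).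
  by rewrite -e1 -e2; field.
have wHE : wH = u1 - wK by rewrite -e1 addrK.
rewrite wHE wKE /F_aa /D aE /F1 /F2 /F11 /F12 /F22 /A.
field.
by rewrite s10 nz s0.
Qed.

End Algebra.

(** * Euler relations for a homogeneous function of H and K *)

Section Relations.
Variables (R : realType) (W W1 W2 W11 W12 W22 : R -> R -> R) (n : nat).
Implicit Types (s t : R).

(* The values of (H, K) at (l1, l2) = (t s, t). *)
Let orbit x y :=
  exists t s, [/\ 0 < t, 0 < s, x = t * (s + 1) & y = t ^+ 2 * s].

Hypothesis gradW : forall x y, orbit x y ->
  has_gradient W x y (W1 x y) (W2 x y).
Hypothesis gradW1 : forall x y, orbit x y ->
  has_gradient W1 x y (W11 x y) (W12 x y).
Hypothesis gradW2 : forall x y, orbit x y ->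
  has_gradient W2 x y (W12 x y) (W22 x y).

(* The function l1, l2 |-> W (l1 + l2) (l1 * l2) at (s, 1). *)
Let profile s := W (s + 1) s.
Let profile1 s := W1 (s + 1) s + W2 (s + 1) s.
Let profile2 s := W11 (s + 1) s + 2 * W12 (s + 1) s + W22 (s + 1) s.

Let orbit_scaled t s : 0 < t -> 0 < s ->
  orbit (t * (s + 1)) (t ^+ 2 * s).
Proof. by exists t, s. Qed.

Let is_derive_succ s : is_derive s 1 (fun s => s + 1) 1.
Proof.
have h := is_derive_add (is_derive_id s 1) (is_derive_cst (1 : R) s 1).
by apply: (is_derive_eq h); rewrite addr0.
Qed.

Let is_derive_along_profile f f1 f2 s :
  (forall x y, orbit x y -> has_gradient f x y (f1 x y) (f2 x y)) ->
  0 < s -> is_derive s 1 (fun s => f (s + 1) s) (f1 (s + 1) s + f2 (s + 1) s).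
Proof.
move=> gf s0; have As : orbit (s + 1) s.
  by exists 1, s; rewrite expr1n !mul1r.
have h := gf _ _ As _ id s _ _ erefl erefl (is_derive_succ s)
  (is_derive_id s 1).
by apply: (is_derive_eq h); rewrite !mulr1.
Qed.

Let is_derive_along_scaling f f1 f2 t s :
  (forall x y, orbit x y -> has_gradient f x y (f1 x y) (f2 x y)) ->
  0 < t -> 0 < s ->
  is_derive t 1 (fun t => f (t * (s + 1)) (t ^+ 2 * s))
    (f1 (t * (s + 1)) (t ^+ 2 * s) * (s + 1)
     + f2 (t * (s + 1)) (t ^+ 2 * s) * (2 * t * s)).
Proof.
move=> gf t0 s0.
apply: (gf _ _ (orbit_scaled t0 s0) (fun t => t * (s + 1))
  (fun t => t ^+ 2 * s)) => //; first exact: is_derive_affine.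
have h := is_derive_mul (is_derive_exp 2 (is_derive_id t 1))
  (is_derive_cst s t 1).
by apply: (is_derive_eq h); rewrite /= expr1; ring.
Qed.

Lemma is_derive_profile s : 0 < s -> is_derive s 1 profile (profile1 s).
Proof. exact: is_derive_along_profile gradW. Qed.

Lemma is_derive_profile1 s : 0 < s -> is_derive s 1 profile1 (profile2 s).
Proof.
move=> s0; apply: (is_derive_eq (is_derive_add
  (is_derive_along_profile gradW1 s0) (is_derive_along_profile gradW2 s0))).
by rewrite /profile2; ring.
Qed.

Hypothesis W_homog : forall t s, 0 < t -> 0 < s ->
  W (t * (s + 1)) (t ^+ 2 * s) = t ^+ n * profile s.

(** Differentiating in t the homogeneity relation on the ray through (s, 1).
The relation is needed for all t, not only at the point t = 1, because it is
differentiated once more. *)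
Lemma euler_scaled t s : 0 < t -> 0 < s ->
  (s + 1) * W1 (t * (s + 1)) (t ^+ 2 * s)
    + 2 * s * t * W2 (t * (s + 1)) (t ^+ 2 * s)
  = n%:R * profile s * t ^+ n.-1.
Proof.
move=> t0 s0.
have h1 := is_derive_along_scaling gradW t0 s0.
have h2 := is_derive_mul (is_derive_exp n (is_derive_id t 1))
  (is_derive_cst (profile s) t 1).
have := near_is_derive_uniq _ h1 h2; rewrite /= => e.
transitivity (t ^+ n.-1 *+ n * 1 * profile s + t ^+ n * 0); last by ring.
rewrite -e; first by ring.
by near=> x; rewrite W_homog //; near: x; exact: lt_nbhsr.
Unshelve. all: by end_near. Qed.

Lemma euler_profile s : 0 < s ->
  (s + 1) * W1 (s + 1) s + 2 * s * W2 (s + 1) s = n%:R * profile s.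
Proof.
by move=> s0; have := euler_scaled ltr01 s0; rewrite !expr1n !mul1r !mulr1.
Qed.

(** The derivative of [euler_profile] along the profile curve: it determines
the mixed values of the Hessian on profile and radial directions. *)
Lemma euler_profile_deriv s : 0 < s ->
  W1 (s + 1) s + 2 * W2 (s + 1) s
    + (s + 1) * (W11 (s + 1) s + W12 (s + 1) s)
    + 2 * s * (W12 (s + 1) s + W22 (s + 1) s)
  = n%:R * profile1 s.
Proof.
move=> s0.
have h1 := is_derive_add
  (is_derive_mul (is_derive_succ s) (is_derive_along_profile gradW1 s0))
  (is_derive_mul (is_derive_affine 2 s) (is_derive_along_profile gradW2 s0)).
have h2 := is_derive_mul (is_derive_cst (n%:R : R) s 1) (is_derive_profile s0).
have := near_is_derive_uniq _ h1 h2; rewrite /= => e.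
transitivity (0 * profile s + n%:R * profile1 s); last by rewrite mul0r add0r.
rewrite -e; first by ring.
by near=> x; rewrite [x * 2]mulrC euler_profile //; near: x; exact: lt_nbhsr.
Unshelve. all: by end_near. Qed.

(** The derivative of [euler_scaled] at t = 1: the Hessian in the radial
direction. *)
Lemma euler_second s : 0 < s ->
  2 * s * W2 (s + 1) s + (s + 1) ^+ 2 * W11 (s + 1) s
    + 4 * s * (s + 1) * W12 (s + 1) s + 4 * s ^+ 2 * W22 (s + 1) s
  = n%:R * (n%:R - 1) * profile s.
Proof.
move=> s0.
have h1 := is_derive_add
  (is_derive_mul (is_derive_cst (s + 1) (1 : R) 1)
    (is_derive_along_scaling gradW1 ltr01 s0))
  (is_derive_mul (is_derive_affine (2 * s) 1)
    (is_derive_along_scaling gradW2 ltr01 s0)).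
have h2 := is_derive_mul (is_derive_cst (n%:R * profile s) (1 : R) 1)
  (is_derive_exp n.-1 (is_derive_id (1 : R) 1)).
have := near_is_derive_uniq _ h1 h2; rewrite /= !expr1n !mul1r => e.
have -> : n%:R * (n%:R - 1) = (n.-1)%:R * n%:R :> R.
  by case: n => [|m]; rewrite ?mul0r ?mulr0 // -natr1 addrK mulrC.
transitivity (0 * 1 + n%:R * profile s * (1 *+ n.-1 * 1)); last by ring.
rewrite -e; first by ring.
near=> x; rewrite [x * (2 * s)]mulrC euler_scaled //.
by near: x; exact: lt_nbhsr.
Unshelve. all: by end_near. Qed.

End Relations.

Section GradientTerms.
Variable R : realType.

Lemma gradient_termsE (F W : R -> R -> R) (s : R) : s != 1 ->
  gradient_terms F W s 1 =
  gradient_form s (pd1 F s 1) (pd2 F s 1) (pd1 (pd1 F) s 1) (pd2 (pd1 F) s 1)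
    (pd2 (pd2 F) s 1) (pd1 W (s + 1) s) (pd2 W (s + 1) s)
    (pd1 (pd1 W) (s + 1) s) (pd2 (pd1 W) (s + 1) s) (pd2 (pd2 W) (s + 1) s).
Proof.
move=> s1; rewrite /gradient_terms /a1 /F_quotient /ext_diag (negPf s1).
by rewrite !mulr1 !mul1r /gradient_form.
Qed.

Lemma gradient_terms_gauss (sigma s : R) (W : R -> R -> R) : 0 < s -> s != 1 ->
  let k := gauss_power (sigma - 1 - 1) s 1 in
  gradient_terms (gauss_power sigma) W s 1 =
  gradient_form s (sigma * s * k) (sigma * s ^+ 2 * k)
    (sigma * (sigma - 1) * k) (sigma ^+ 2 * s * k)
    (sigma * (sigma - 1) * s ^+ 2 * k) (pd1 W (s + 1) s) (pd2 W (s + 1) s)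
    (pd1 (pd1 W) (s + 1) s) (pd2 (pd1 W) (s + 1) s) (pd2 (pd2 W) (s + 1) s).
Proof.
move=> s0 s1 k; apply: (etrans (gradient_termsE _ _ s1)).
have kS : gauss_power (sigma - 1) s 1 = s * k.
  by rewrite (gauss_powerS _ s0 ltr01) mulr1.
have e1 := pd1_gauss sigma s0 ltr01.
have e2 := pd2_gauss sigma s0 ltr01.
have e11 := pd11_gauss sigma s0 ltr01.
have e12 := pd12_gauss sigma s0 ltr01.
have e22 := pd22_gauss sigma s0 ltr01.
have form_eq F1 F2 F11 F12 F22 F1' F2' F11' F12' F22' :
    F1 = F1' -> F2 = F2' -> F11 = F11' -> F12 = F12' -> F22 = F22' ->
    forall wH wK wHH wHK wKK,
    gradient_form s F1 F2 F11 F12 F22 wH wK wHH wHK wKK =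
    gradient_form s F1' F2' F11' F12' F22' wH wK wHH wHK wKK.
  by move=> -> -> -> -> ->.
apply: form_eq; [apply: (etrans e1)|apply: (etrans e2)|apply: (etrans e11)
  |apply: (etrans e12)|apply: (etrans e22)].
- by rewrite kS; ring.
- by rewrite kS; ring.
- by rewrite -/k; ring.
- by rewrite -/k; ring.
- by rewrite -/k; ring.
Qed.

End GradientTerms.

(** * The differential inequality has no global solution *)

Section Decay.
Variable R : realType.

(** Since g + e ln is nonincreasing, and ln is unbounded. *)
Lemma no_logarithmic_decay (g dg : R -> R) (s0 e : R) : 0 < s0 -> 0 < e ->
  (forall s, s0 <= s -> is_derive s 1 g (dg s)) ->
  (forall s, s0 <= s -> s * dg s <= - e) ->
  (forall s, s0 <= s -> 0 <= g s) -> False.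
Proof.
move=> s0_gt0 e_gt0 hg dgE g_ge0.
(* With ln s1 - ln s0 = M, the bound at s1 is g s0 - e M = -1. *)
pose M := (g s0 + 1) / e; pose s1 := s0 * expR M.
have M_gt0 : 0 < M by rewrite divr_gt0 // ltr_wpDl // g_ge0.
have s01 : s0 < s1 by rewrite /s1 ltr_pMr // expR_gt1.
have hh s : s0 <= s -> is_derive s 1 (fun s => g s + e * ln s) (dg s + e / s).
  move=> s0s; have s_gt0 := lt_le_trans s0_gt0 s0s.
  have h := is_derive_add (hg s s0s)
    (is_derive_mul (is_derive_cst e s 1) (is_derive1_ln s_gt0)).
  by apply: (is_derive_eq h); rewrite mul0r add0r.
have [||c] :=
  @MVT R (fun s => g s + e * ln s) (fun s => dg s + e / s) s0 s1 s01.
- by move=> s; rewrite in_itv /= => /andP[/ltW /hh].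
- apply: continuous_in_subspaceT => s.
  rewrite inE /= in_itv /= => /andP[/hh + _].
  exact: is_derive_continuous.
rewrite in_itv /= => /andP[/ltW s0c _].
have c_gt0 := lt_le_trans s0_gt0 s0c.
rewrite /s1 lnM ?posrE ?expR_gt0 // expRK.
have -> : e * (ln s0 + M) = e * ln s0 + (g s0 + 1).
  by rewrite /M; field; rewrite gt_eqF.
have : (dg c + e / c) * (s1 - s0) <= 0.
  apply: mulr_le0_ge0; last by rewrite subr_ge0 ltW.
  rewrite -(pmulr_rle0 _ c_gt0) mulrDr mulrCA divff ?gt_eqF // mulr1.
  by have := dgE c s0c; lra.
have := g_ge0 s1 (ltW s01).
rewrite -/s1; lra.
Qed.

(** With q = s u' / u the last hypothesis, divided by u^3, is the differential
inequality for q, and the one before it is q > d.  To allow zeros of u, the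
argument works with g = (u / (s u'))^2 = 1 / q^2, for which it becomes
s g' <= - 2 (sigma - (s + 1) / (s - 1)) / d^2. *)
Lemma no_steep_profile (sigma d : R) (u u1 u2 : R -> R) : 1 < sigma -> 0 < d ->
  (forall s : R, 1 < s -> is_derive s 1 u (u1 s)) ->
  (forall s : R, 1 < s -> is_derive s 1 u1 (u2 s)) ->
  (forall s : R, 1 < s -> 0 <= u s) ->
  (forall s : R, 1 < s -> d * u s < s * u1 s) ->
  (forall s : R, 1 < s -> let A := s * u1 s in
    A * (2 * A - d * u s)
      * (sigma * (2 * A - d * u s) - (s + 1) / (s - 1) * A)
    - d ^+ 2 * s * u s * ((u1 s + s * u2 s) * u s - A * u1 s) <= 0) ->
  False.
Proof.
move=> sigma1 d0 hu hu1 u_ge0 uA ineq.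
(* From s0 on, (s + 1) / (s - 1) is at most the mean (1 + sigma) / 2. *)
pose s0 := (sigma + 3) / (sigma - 1).
have sig0 : 0 < sigma - 1 by rewrite subr_gt0.
have s0_gt1 : 1 < s0 by rewrite /s0 ltr_pdivlMr //; lra.
have A_gt0 s : 1 < s -> 0 < s * u1 s.
  move=> s1; apply: le_lt_trans (uA s s1).
  by rewrite mulr_ge0 ?u_ge0 // ltW.
pose g s := (u s / (s * u1 s)) ^+ 2.
pose dg s := 2 * (u s / (s * u1 s)) *
  ((u1 s * (s * u1 s) - u s * (u1 s + s * u2 s)) / (s * u1 s) ^+ 2).
apply: (@no_logarithmic_decay g dg s0 ((sigma - 1) / d ^+ 2)).
- exact: lt_trans ltr01 s0_gt1.
- by rewrite divr_gt0 // exprn_gt0.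
- move=> s /(lt_le_trans s0_gt1) s1.
  have hA := is_derive_mul (is_derive_id s 1) (hu1 s s1).
  have A0 : s * u1 s != 0 by rewrite gt_eqF // A_gt0.
  have h := is_derive_exp 2 (is_derive_div (t := s) (g := fun s => s * u1 s)
    A0 (hu s s1) hA).
  by apply: (is_derive_eq h); rewrite /dg /= mul1r expr1; ring.
- move=> s s0s; have s1 := lt_le_trans s0_gt1 s0s.
  have := ineq s s1; have := uA s s1; have := A_gt0 s s1; have := u_ge0 s s1.
  rewrite /dg.
  set A := s * u1 s; set v := u s; set c := (s + 1) / (s - 1).
  move=> v0 A0 vA le0.
  have c_le : c <= (1 + sigma) / 2.
    rewrite /c ler_pdivrMr ?subr_gt0 //.
    by move: s0s; rewrite /s0 ler_pdivrMr //; lra.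
  set B := 2 * A - d * v in le0.
  have AB : A <= B by rewrite /B; lra.
  have B2 : A * (sigma - 1) / 2 <= sigma * B - c * A.
    have h1 : c * A <= (1 + sigma) / 2 * A by rewrite ler_pM2r.
    have h2 : sigma * A <= sigma * B by rewrite ler_pM2l //; lra.
    lra.
  have B3 : A * (A * (sigma - 1) / 2) <= B * (sigma * B - c * A).
    apply: ler_pM => //; first exact: ltW.
    by rewrite divr_ge0 // mulr_ge0 // ltW.
  have B4 : A * (A * (A * (sigma - 1) / 2)) <= A * (B * (sigma * B - c * A)).
    by rewrite ler_pM2l.
  have -> : s * (2 * (v / A) * ((u1 s * A - v * (u1 s + s * u2 s)) / A ^+ 2))
    = - (2 * (d ^+ 2 * s * v * ((u1 s + s * u2 s) * v - A * u1 s))) / A ^+ 3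
      / d ^+ 2.
    by field; rewrite !gt_eqF.
  rewrite -[X in _ <= X]mulNr ler_pM2r ?invr_gt0 ?exprn_gt0 //.
  rewrite ler_pdivrMr ?exprn_gt0 //.
  have -> : - (sigma - 1) * A ^+ 3 = - (2 * (A * (A * (A * (sigma - 1) / 2)))).
    by field.
  rewrite lerN2 ler_pM2l //.
  apply: (le_trans B4); rewrite -subr_le0; move: le0.
  by rewrite -mulrA.
- by move=> s _; rewrite sqr_ge0.
Qed.

End Decay.

(** * Homogeneous symmetric rational functions *)

Section HomogeneousRational.
Variables (R : realType) (p q : mpoly 2 R).
Hypothesis q_gt0 : forall l1 l2, 0 < l1 -> 0 < l2 -> 0 < eval2 q l1 l2.
Hypothesis p_homog : p \is ishomog mdeg.
Hypothesis q_homog : q \is ishomog mdeg.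
Hypothesis q_neq0 : q != 0.
Hypothesis deg_lt : (mpoly.msize q < mpoly.msize p)%N.

Definition ratdeg : nat := ((mpoly.msize p).-1 - (mpoly.msize q).-1)%N.

Lemma ratdeg_gt0 : (0 < ratdeg)%N.
Proof.
have q0 : (0 < mpoly.msize q)%N by rewrite lt0n msize_poly_eq0.
rewrite /ratdeg subn_gt0 -ltnS prednK // prednK //.
exact: ltn_trans deg_lt.
Qed.

Lemma ratfun_homog t x y : 0 < t -> 0 < x -> 0 < y ->
  ratfun p q (t * x) (t * y) = t ^+ ratdeg * ratfun p q x y.
Proof.
move=> t0 x0 y0; rewrite /ratfun !eval2_homog //.
have -> : (mpoly.msize p).-1 = (ratdeg + (mpoly.msize q).-1)%N.
  by rewrite subnK // -!subn1 leq_sub2r // ltnW.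
rewrite exprD.
have tm0 : t ^+ (mpoly.msize q).-1 != 0 by rewrite expf_neq0 // gt_eqF.
have qxy0 : eval2 q x y != 0 by rewrite gt_eqF // q_gt0.
move: (t ^+ _.-1) (eval2 q x y) tm0 qxy0 => a b a0 b0.
by move: (t ^+ _) (eval2 p x y) => c e; field; rewrite a0 b0.
Qed.

Hypothesis w_sym : forall l1 l2, 0 < l1 -> 0 < l2 ->
  ratfun p q l1 l2 = ratfun p q l2 l1.
Hypothesis w_decr : forall s, 0 < s -> s < 1 -> pd1 (ratfun p q) s 1 < 0.

(** Differentiating the reflection formula u(s) = s^d u(1/s): the derivative of
the second factor contributes - u'(1/s) / s^2, which is positive. *)
Lemma ratfun_steep (u u1 : R -> R) :
  (forall s : R, 0 < s -> u s = ratfun p q s 1) ->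
  (forall s : R, 0 < s -> is_derive s 1 u (u1 s)) ->
  forall s : R, 1 < s -> ratdeg%:R * u s < s * u1 s.
Proof.
move=> uE hu s s1.
have s0 : 0 < s by exact: lt_trans s1.
have sV0 : 0 < s^-1 by rewrite invr_gt0.
have u1V : u1 s^-1 < 0.
  have <- : pd1 (ratfun p q) s^-1 1 = u1 s^-1.
    apply: is_derive_derive1; apply: near_eq_is_derive (hu _ sV0).
    by near=> x; apply: uE; near: x; exact: lt_nbhsr.
  by apply: w_decr; rewrite // invf_lt1.
have refl (x : R) : 0 < x -> u x = x ^+ ratdeg * u x^-1.
  move=> x0; have xV0 : 0 < x^-1 by rewrite invr_gt0.
  by rewrite !uE // -ratfun_homog // mulfV ?gt_eqF // mulr1 w_sym.
have sn0 : s != 0 by rewrite gt_eqF.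
have h1 := is_derive1_comp (hu _ sV0)
  (is_deriveV (f := id) sn0 (is_derive_id s 1)).
have h2 := is_derive_mul (is_derive_exp ratdeg (is_derive_id s 1)) h1.
have := near_is_derive_uniq _ (hu s s0) h2; move=> ->; last first.
  by near=> x; rewrite refl //; near: x; exact: lt_nbhsr.
rewrite refl // /= /GRing.scale /=.
have [m ->] : exists m, ratdeg = m.+1.
  by exists ratdeg.-1; rewrite prednK ?ratdeg_gt0.
rewrite /= -subr_gt0.
have -> : s * (s ^+ m *+ m.+1 * 1 * u s^-1
   + s ^+ m.+1 * (u1 s^-1 * (- s ^- 2 * 1)))
   - m.+1%:R * (s ^+ m.+1 * u s^-1) = s ^+ m * (- u1 s^-1).
  by rewrite !exprS; field.
by rewrite mulr_gt0 ?exprn_gt0 // oppr_gt0.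
Unshelve. all: by end_near. Qed.

End HomogeneousRational.

(** * Nonexistence of maximum-principle functions *)

Theorem theorem1p2 (R : realType) (sigma : R) (hsigma : 1 < sigma) :
  ~ exists p q : mpoly 2 R,
      maximum_principle_function (gauss_power sigma) p q.
Proof.
move=> [p [q [_ q_neq0 p_homog q_homog w_sym p_ge0 q_gt0 _ deg_lt decr _
  [W [P [Q [WPQ HK]]] evol]]]].
have WE : quotient_off Q P 1 W by rewrite WPQ; exact: quotient_off_ratfun.
pose n := ratdeg p q.
pose u (s : R) := W (s + 1) s.
pose u1 (s : R) := pd1 W (s + 1) s + pd2 W (s + 1) s.
pose u2 (s : R) := pd1 (pd1 W) (s + 1) s + 2 * pd2 (pd1 W) (s + 1) s
  + pd2 (pd2 W) (s + 1) s.
have scaled (t s : R) :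
    t * (s + 1) = t * s + t * 1 /\ t ^+ 2 * s = t * s * (t * 1).
  by split; ring.
have grad P' k f (x y : R) : quotient_off Q P' k f ->
    (exists t s : R, [/\ 0 < t, 0 < s, x = t * (s + 1) & y = t ^+ 2 * s]) ->
    has_gradient f x y (pd1 f x y) (pd2 f x y).
  move=> fE [t [s [t0 s0 -> ->]]]; apply: (quotient_has_gradient fE).
  have [-> ->] := scaled t s.
  by apply: (HK _ _ _ _).1; rewrite ?mulr1 // mulr_gt0.
have gradW x y := grad _ _ _ x y WE.
have gradW1 x y := grad _ _ _ x y (pd1_quotient WE).
have gradW2 (x y : R) :
    (exists t s : R, [/\ 0 < t, 0 < s, x = t * (s + 1) & y = t ^+ 2 * s]) ->
    has_gradient (pd2 W) x y (pd2 (pd1 W) x y) (pd2 (pd2 W) x y).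
  move=> xy; have := grad _ _ _ x y (pd2_quotient WE) xy.
  rewrite (quotient_pd_comm WE) //; move: xy => [t [s [t0 s0 -> ->]]].
  have [-> ->] := scaled t s.
  by apply: (HK _ _ _ _).1; rewrite ?mulr1 // mulr_gt0.
have uE (s : R) : 0 < s -> u s = ratfun p q s 1.
  by move=> s0; have [_ <-] := HK s 1 s0 ltr01; rewrite mulr1.
have homog (t s : R) : 0 < t -> 0 < s ->
    W (t * (s + 1)) (t ^+ 2 * s) = t ^+ n * u s.
  move=> t0 s0; have [-> ->] := scaled t s; rewrite uE //.
  by rewrite (HK _ _ _ _).2 ?mulr1 ?mulr_gt0 // -{2}[t]mulr1 ratfun_homog.
have hu := is_derive_profile gradW.
have hu1 := is_derive_profile1 gradW1 gradW2.
have steep := ratfun_steep q_gt0 p_homog q_homog q_neq0 deg_lt w_sym decr uE hu.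
apply: (@no_steep_profile R sigma n%:R u u1 u2) => //.
- by rewrite ltr0n ratdeg_gt0.
- by move=> s s1; apply: hu; exact: lt_trans s1.
- by move=> s s1; apply: hu1; exact: lt_trans s1.
- move=> s s1; have s0 : 0 < s by exact: lt_trans s1.
  by rewrite uE // divr_ge0 ?p_ge0 // ltW ?q_gt0.
- move=> s s1 /=; have s0 : 0 < s by exact: lt_trans s1.
  have sn1 : s != 1 by rewrite gt_eqF.
  have [_] := evol s 1 s0 ltr01.
  have k0 : 0 < gauss_power (sigma - 1 - 1) s 1.
    by rewrite /gauss_power powR_gt0 // mulr1.
  have nz : s * u1 s - n%:R * u s != 0 by rewrite gt_eqF // subr_gt0 steep.
  have E1 := euler_profile gradW homog s0.
  have E2 := euler_profile_deriv gradW gradW1 gradW2 homog s0.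
  have E3 := euler_second gradW gradW1 gradW2 homog s0.
  have E := gradient_form_gauss sigma (gauss_power (sigma - 1 - 1) s 1)
    s0 sn1 nz erefl E1 erefl E2 E3.
  rewrite (etrans (gradient_terms_gauss sigma W s0 sn1) E).
  rewrite pmulr_rle0 // divr_gt0 ?exprn_even_gt0 //= divr_gt0 // mulr_gt0 //.
  exact: lt_trans hsigma.
Qed.
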